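(* Let $\mathbb{F}_q$ be a finite field of characteristic at least $5$ and let $\mathcal{F}=\mathbb{F}_q(x,y)$ be a cubic function field given in standard form by $y^3-Ay+B=0$ with $A,B\in\mathbb{F}_q[x]$. Let $n_1=\deg(A)$, $n_0=\deg(B)$ and assume $3n_1\neq 2n_0$. Let $\alpha=a_0+a_1y+a_2y^2\in\mathcal{O}^*$ with $a_0,a_1,a_2\in\mathbb{F}_q[x]$. Then $$(\alpha^k)_{max}=k\,\alpha_{max}\qquad\text{for all } k\in\mathbb{N}.$$
   Context: Cubic function field in standard form: $\mathcal{F}=\mathbb{F}_q(x,y)$ where $x$ is transcendental over $\mathbb{F}_q$, $T^3-A(x)T+B(x)\in\mathbb{F}_q[x][T]$ is irreducible over $\mathbb{F}_q(x)$ with root $y$, at least one of $A,B$ is non-constant, there is no non-constant $Q\in\mathbb{F}_q[x]$ with $Q^2\mid A$ and $Q^3\mid B$, and $\mathbb{F}_q$ is algebraically closed in $\mathcal{F}$. $\mathcal{O}$ is the integral closure of $\mathbb{F}_q[x]$ in $\mathcal{F}$ and $\mathcal{O}^*$ its unit group. $\deg(0)=-\infty$. Maximum value: an infinite place of $\mathcal{F}$ is a place above the infinite place $P_\infty$ of $\mathbb{F}_q(x)$ (with $v_{P_\infty}(G)=-\deg G$ for polynomials $G$); let $e_{P'}=e(P'|P_\infty)$. If $3n_1>2n_0$ there is at least one infinite place $P'$ of $\mathcal{F}$ with $v_{P'}(y)=-e_{P'}n_1/2$; if $3n_1<2n_0$ there is at least one infinite place $P'$ with $v_{P'}(y)=-e_{P'}n_0/3$.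 Let $P_1$ be such a place with minimal ramification index among such places. For $\alpha=a_0+a_1y+a_2y^2\in\mathcal{O}$ with $a_i\in\mathbb{F}_q[x]$ define $$\alpha_{max}=\max\{-v_{P_1}(a_0),\,-v_{P_1}(a_1y),\,-v_{P_1}(a_2y^2)\}.$$ This does not depend on the choice of $P_1$ (for fixed $y$). *)

(* Defs.v *)
From HB Require Import structures.
From mathcomp Require Import all_boot all_order all_algebra all_field.
From mathcomp Require Import constructive_ereal.

Set Implicit Arguments.
Unset Strict Implicit.
Unset Printing Implicit Defensive.

Import Order.TTheory GRing.Theory Num.Theory.
Local Open Scope ring_scope.

Notation ratfun Fq := {fraction {poly Fq}}.

(* With the convention deg 0 = -oo. *)
Definition deg (Fq : fieldType) (G : {poly Fq}) : \bar int :=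
  if G == 0 then -oo%E else (Posz (size G).-1)%:E%E.

(* The valuation of Fq(x) at the infinite place, deg (denominator) -
   deg (numerator); it is +oo at 0.  By vinf_frac below the choice of the
   fraction representing f is irrelevant. *)
Definition vinf (Fq : fieldType) (f : ratfun Fq) : \bar int :=
  (deg (\d_(repr f)) - deg (\n_(repr f)))%E.

Lemma degM (Fq : fieldType) (G H : {poly Fq}) :
  deg (G * H) = (deg G + deg H)%E.
Proof.
rewrite /deg mulf_eq0; have [//|G0] := eqVneq G 0.
have [//|H0] := eqVneq H 0.
rewrite /= -EFinD -PoszD size_mul // -[in RHS]subn1 -[in RHS]subn1 -subn2.
by rewrite addnBAC ?addnBA -?subnDA // lt0n size_poly_eq0.
Qed.

Lemma vinf_frac (Fq : fieldType) (G H : {poly Fq}) : H != 0 ->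
  vinf (tofrac G / tofrac H) = (deg H - deg G)%E.
Proof.
move=> H0; have : tofrac G / tofrac H * tofrac H = tofrac G.
  by rewrite divfK ?tofrac_eq0.
move: (tofrac G / tofrac H) => f fH; rewrite /vinf.
have E : \n_(repr f) * H = \d_(repr f) * G.
  have d0 : tofrac \d_(repr f) != 0 by rewrite tofrac_eq0 denom_ratioP.
  have Df : f * tofrac \d_(repr f) = tofrac \n_(repr f).
    rewrite -{1}[f]reprK; unlock FracField.tofrac.
    rewrite -[LHS]FracField.pi_mul.
    apply/eqmodP; rewrite /= FracField.equivfE /FracField.mulf /=.
    by rewrite !numden_Ratio ?mulr1 ?oner_neq0 ?denom_ratioP // mulrC.
  have : tofrac (\n_(repr f) * H) == tofrac (\d_(repr f) * G).
    by rewrite !tofracM -fH -Df mulrCA mulrA.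
  by rewrite tofrac_eq => /eqP.
have := congr1 (@deg Fq) E; rewrite !degM /deg (negPf H0).
rewrite (negPf (denom_ratioP (repr f))).
case: eqP => _; case: eqP => _ //= -[e].
rewrite -!EFinD; congr _%:E; apply/eqP; rewrite subr_eq addrAC eq_sym subr_eq.
by rewrite -!PoszD addnC e addnC.
Qed.

Section FunctionField.

Variables (Fq : finFieldType) (L : fieldExtType (ratfun Fq)).

Definition ratfun_emb (f : ratfun Fq) : L := f%:A.
Definition poly_emb (G : {poly Fq}) : L := ratfun_emb (tofrac G).
Definition const_emb (c : Fq) : L := poly_emb c%:P.

(* T^3 - A T + B as a polynomial over Fq(x). *)
Definition cubic (A B : {poly Fq}) : {poly (ratfun Fq)} :=
  'X^3 - tofrac A *: 'X + (tofrac B)%:P.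

(* L = Fq(x, y) is a cubic function field in standard form; x is the
   indeterminate of {poly Fq}, hence transcendental over Fq. *)
Record standard_form (A B : {poly Fq}) (y : L) : Prop := StandardForm {
  std_irreducible : irreducible_poly (cubic A B);
  std_root : y ^+ 3 - poly_emb A * y + poly_emb B = 0;
  std_gen : <<1%VS; y>>%VS = fullv;
  std_nonconst : (1 < size A)%N \/ (1 < size B)%N;
  std_minimal : forall Q : {poly Fq},
    (1 < size Q)%N -> ~~ ((Q ^+ 2 %| A) && (Q ^+ 3 %| B));
  std_constants : forall z : L,
    (exists2 p : {poly Fq}, p != 0 & root (map_poly const_emb p) z) ->
    exists c : Fq, z = const_emb c
}.

(* The maximal order O, i.e. the integral closure of Fq[x] in L. *)
Definition in_O (z : L) : Prop := integralOver poly_emb z.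

Definition unit_O (z : L) : Prop :=
  in_O z /\ exists2 w : L, in_O w & z * w = 1.

(* A place of L / Fq, given by its normalized discrete valuation (trivial on
   Fq, with value group the integers and +oo at 0). *)
Record place := Place {
  valuation :> L -> \bar int;
  place_v0 : valuation 0 = +oo%E;
  place_v_fin : forall z, z != 0 -> valuation z \is a fin_num;
  place_vM : forall z w, valuation (z * w) = (valuation z + valuation w)%E;
  place_vD : forall z w,
    (Order.min (valuation z) (valuation w) <= valuation (z + w)%R)%E;
  place_v_const : forall c : Fq, c != 0 -> valuation (const_emb c) = 0%E;
  place_v_unif : exists z, valuation z = 1%E
}.

(* P lies above the infinite place of Fq(x). *)
Definition infinite_place (P : place) : Prop :=
  forall f : ratfun Fq, (0 < P (ratfun_emb f))%E = (0 < vinf f)%E.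

(* e is the ramification index e(P | P_oo). *)
Definition ramification_index (P : place) (e : nat) : Prop :=
  (0 < e)%N /\
  forall f : ratfun Fq, P (ratfun_emb f) = ((Posz e)%:E * vinf f)%E.

(* P is an infinite place, of ramification index e, with v_P(y) = - e n1 / 2
   if 3 n1 > 2 n0, and v_P(y) = - e n0 / 3 if 3 n1 < 2 n0; denominators are
   cleared to stay in \bar int. *)
Definition critical_place (A B : {poly Fq}) (y : L) (P : place) (e : nat) :
    Prop :=
  [/\ infinite_place P, ramification_index P e,
      (2%:E * deg B < 3%:E * deg A ->
       2%:E * P y = - ((Posz e)%:E * deg A))%E &
      (3%:E * deg A < 2%:E * deg B ->
       3%:E * P y = - ((Posz e)%:E * deg B))%E].

(* The places that may be chosen as P_1: critical, with minimal ramification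
   index among the critical places. *)
Definition minimal_critical_place (A B : {poly Fq}) (y : L) (P : place) :
    Prop :=
  exists2 e : nat, critical_place A B y P e &
    forall (P' : place) (e' : nat), critical_place A B y P' e' -> (e <= e')%N.

(* The coefficient a_i of z = a_0 + a_1 y + a_2 y^2, with a_i in (the image
   in L of) Fq(x); see ycoefE. *)
Definition ycoef (y z : L) (i : nat) : L := (Fadjoin_poly 1%AS y z)`_i.

Lemma ycoefE (A B : {poly Fq}) (y : L) (c0 c1 c2 : ratfun Fq) :
  standard_form A B y ->
  let z := ratfun_emb c0 + ratfun_emb c1 * y + ratfun_emb c2 * y ^+ 2 in
  [/\ ycoef y z 0 = ratfun_emb c0, ycoef y z 1 = ratfun_emb c1
    & ycoef y z 2 = ratfun_emb c2].
Proof.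
move=> std z; pose q : {poly L} :=
  (ratfun_emb c0)%:P + ratfun_emb c1 *: 'X + ratfun_emb c2 *: 'X^2.
have cE : map_poly (in_alg L) (cubic A B) =
    'X^3 - poly_emb A *: 'X + (poly_emb B)%:P.
  by rewrite /cubic rmorphD rmorphB /= map_polyXn map_polyZ map_polyX map_polyC.
have croot : root (map_poly (in_alg L) (cubic A B)) y.
  rewrite cE rootE !hornerE; apply/eqP.
  by rewrite -[RHS](std_root std).
have szc : size (cubic A B) = 4%N.
  rewrite /cubic -addrA size_polyDl size_polyXn //.
  rewrite ltnS (leq_trans (size_polyD _ _)) // geq_max size_polyN.
  by rewrite (leq_trans (size_scale_leq _ _)) ?size_polyX ?(leq_trans (size_polyC_leq1 _)).
have deg3 : adjoin_degree 1%AS y = 3.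
  have [m Dm] := polyOver1P (minPolyOver 1%AS y).
  have : minPoly 1%AS y %| map_poly (in_alg L) (cubic A B).
    by apply: minPoly_dvdp => //; apply/polyOver1P; exists (cubic A B).
  have := size_minPoly 1%AS y.
  rewrite Dm size_map_poly dvdp_map => szm mc; have [_ /(_ m)] := std_irreducible std.
  rewrite szm eqSS => /(_ isT mc) /eqp_size.
  by rewrite szm szc => /eq_add_S.
have in1 c : ratfun_emb c \in 1%AS by apply/vlineP; exists c.
have qO : q \is a polyOver 1%AS.
  rewrite /q -!mul_polyC; apply: rpredD; first apply: rpredD.
  - by rewrite polyOverC in1.
  - by apply: rpredM; rewrite ?polyOverC ?in1 ?polyOverX.
  - by apply: rpredM; rewrite ?polyOverC ?in1 ?polyOverXn.
have qs : (size q <= adjoin_degree 1%AS y)%N.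
  rewrite deg3; apply: leq_trans (size_polyD _ _) _; rewrite geq_max.
  apply/andP; split; last by rewrite (leq_trans (size_scale_leq _ _)) ?size_polyXn.
  apply: leq_trans (size_polyD _ _) _; rewrite geq_max.
  by rewrite (leq_trans (size_polyC_leq1 _)) //= (leq_trans (size_scale_leq _ _)) ?size_polyX.
have qy : q.[y] = z by rewrite /q !hornerD !hornerZ hornerC hornerX hornerXn.
rewrite /ycoef (Fadjoin_poly_unique qO qs qy) /q.
by split; rewrite !coefE ?mulr0 ?mulr1 ?addr0 ?add0r.
Qed.

(* The maximum value of z, relative to the place P_1 = P. *)
Definition maxval (P : place) (y z : L) : \bar int :=
  Order.max (- P (ycoef y z 0))%E
    (Order.max (- P (ycoef y z 1 * y)%R)%E (- P (ycoef y z 2 * y ^+ 2)%R)%E).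

End FunctionField.

(* Main.v *)
Require Import Defs.
From HB Require Import structures.
From mathcomp Require Import all_boot all_order all_algebra all_field.
From mathcomp Require Import constructive_ereal.
From mathcomp Require Import ring zify.

Set Implicit Arguments.
Unset Strict Implicit.
Unset Printing Implicit Defensive.

(** Write an element of L as z = c0 + c1 y + c2 y^2 with c_i in Fq(x), and let
P be the chosen place.  Its maximum value is, up to sign, the smallest of the
P-values of c0, c1 y and c2 y^2: it is a Gauss norm on L, defined by these
coordinates rather than by P z.  The point is that this norm is multiplicative
on powers.

For z nonzero, choose t in L with the same P-value as the smallest coordinate
and divide the coordinates by t.  The scaled coordinates multiply as in
L[Y] / (Y^3 - a Y + b) with a = A / y^2 and b = B / y^3, where Y stands for y
made of size 1 ([scaled_coordM]); the equation of y says a - b = 1.  Because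
3 deg A and 2 deg B differ and P is critical, one of a, b lies in the maximal
ideal of the valuation ring of P ([critical_small]), so the algebra is defined
over the valuation ring, and over the residue field k it becomes
k[Y] / (Y^3 - Y) or k[Y] / (Y^3 - 1).  Both are reduced, as the characteristic
is neither 2 nor 3 ([cubic_reduced]).  The scaled coordinates of z have a
nonzero reduction, hence so do those of z^k scaled by t^k ([content_expn]): the
smallest coordinate of z^k has value P (t^k) = k P t. *)

Import Order.TTheory GRing.Theory Num.Theory.
Local Open Scope ring_scope.

(** * The valuation ring of a place *)

Section ValuationRing.

Variables (Fq : finFieldType) (L : fieldExtType (ratfun Fq)) (P : place L).

Definition integral (t : L) : bool := (0 <= P t)%E.
Definition small (t : L) : bool := (0 < P t)%E.

Lemma small_integral t : small t -> integral t.
Proof. exact: ltW. Qed.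

Lemma integralD s t : integral s -> integral t -> integral (s + t).
Proof.
move=> hs ht; apply: le_trans (place_vD P s t).
by rewrite le_min; apply/andP.
Qed.

Lemma smallD s t : small s -> small t -> small (s + t).
Proof.
move=> hs ht; apply: lt_le_trans (place_vD P s t).
by rewrite lt_min; apply/andP.
Qed.

Lemma integralM s t : integral s -> integral t -> integral (s * t).
Proof. by rewrite /integral place_vM; apply: adde_ge0. Qed.

Lemma smallM s t : integral s -> small t -> small (s * t).
Proof.
rewrite /integral /small place_vM.
by case: (P s) => [x| |]; case: (P t) => [z| |] //=;
  rewrite -?EFinD !(lee_fin, lte_fin) ; lia.
Qed.

Lemma place_v1 : P 1 = 0%E.
Proof.
have <- : const_emb L 1 = 1 :> L.
  by rewrite /const_emb /poly_emb /ratfun_emb tofrac1 scale1r.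
by rewrite place_v_const ?oner_neq0.
Qed.

Lemma integral_nat n : integral n%:R.
Proof.
elim: n => [|n IH]; first by rewrite /integral place_v0 leey.
by rewrite -natr1 integralD // /integral place_v1.
Qed.

Lemma integralX t n : integral t -> integral (t ^+ n).
Proof.
move=> ht; elim: n => [|n IH]; first exact: integral_nat 1.
by rewrite exprS integralM.
Qed.

Lemma integralN t : integral t -> integral (- t).
Proof.
rewrite -mulN1r; apply: integralM.
have: P (-1) = 0%E.
  have <- : const_emb L (-1) = -1 :> L.
    by rewrite /const_emb /poly_emb /ratfun_emb polyCN tofracN tofrac1 scaleN1r.
  by rewrite place_v_const // oppr_eq0 oner_neq0.
by rewrite /integral => ->.
Qed.

Lemma integralB s t : integral s -> integral t -> integral (s - t).
Proof. by move=> hs ht; rewrite integralD ?integralN. Qed.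

Lemma smallN t : small t -> small (- t).
Proof.
rewrite -mulN1r; apply: smallM.
by rewrite integralN // /integral place_v1.
Qed.

Lemma smallB s t : small s -> small t -> small (s - t).
Proof. by move=> hs ht; rewrite smallD ?smallN. Qed.

Lemma small_prime s t :
  integral s -> integral t -> small (s * t) -> small s \/ small t.
Proof.
rewrite /integral /small place_vM.
case: (P s) => [x| |]; case: (P t) => [z| |] //=; rewrite ?ltry; auto.
by rewrite -?EFinD !(lee_fin, lte_fin); lia.
Qed.

Lemma small_sqr t : integral t -> small (t ^+ 2) -> small t.
Proof. by move=> ht; rewrite expr2 => /small_prime[]. Qed.

(** A natural number that is invertible in Fq is a nonzero constant of L, where
every place vanishes. *)
Lemma small_natM n t :
  n%:R != 0 :> Fq -> integral t -> small (n%:R * t) -> small t.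
Proof.
move=> n0 ht /(small_prime (integral_nat n) ht)[] //.
suff -> : n%:R = const_emb L n%:R :> L by rewrite /small place_v_const.
by rewrite /const_emb /poly_emb /ratfun_emb !rmorph_nat scaler_nat.
Qed.

Lemma place_vX t k : t != 0 -> P (t ^+ k) = ((Posz k)%:E * P t)%E.
Proof.
move=> /(place_v_fin P); elim: k => [|k IH] ht; first by rewrite mul0e place_v1.
rewrite exprS place_vM IH //.
by case: (P t) ht => // x _; rewrite -?EFinM -EFinD; congr _%:E; lia.
Qed.

Lemma integral_div u t : t != 0 -> integral (u / t) = (P t <= P u)%E.
Proof.
move=> t0; rewrite -{2}(divfK t0 u) place_vM /integral.
case: (P t) (place_v_fin P t0) => // x _.
case: (P _) => [z| |] //=; rewrite -?EFinD ?lee_fin ?leey //; lia.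
Qed.

Lemma small_div u t : t != 0 -> small (u / t) = (P t < P u)%E.
Proof.
move=> t0; rewrite -{2}(divfK t0 u) place_vM /small.
case: (P t) (place_v_fin P t0) => // x _.
case: (P _) => [z| |] //=; rewrite -?EFinD ?lte_fin ?ltry //; lia.
Qed.

End ValuationRing.

(** * A reduced cubic algebra over the valuation ring *)

(** The product of F[Y] / (Y^3 - a Y + b) in the basis 1, Y, Y^2. *)
Definition cubic_mul {F : comRingType} (a b : F) (u v : F * F * F) : F * F * F :=
  let: (u0, u1, u2) := u in let: (v0, v1, v2) := v in
  (u0 * v0 - (u1 * v2 + u2 * v1) * b,
   u0 * v1 + u1 * v0 + (u1 * v2 + u2 * v1) * a - u2 * v2 * b,
   u0 * v2 + u1 * v1 + u2 * v0 + u2 * v2 * a).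

Definition all3 {T : Type} (S : T -> bool) (u : T * T * T) : bool :=
  let: (u0, u1, u2) := u in [&& S u0, S u1 & S u2].

Section CubicAlgebra.

Variables (Fq : finFieldType) (L : fieldExtType (ratfun Fq)) (P : place L).
Variables a b : L.
Hypothesis ab1 : a - b = 1.
Hypothesis ab_small : small P a \/ small P b.
Hypotheses (two_neq0 : 2%:R != 0 :> Fq) (three_neq0 : 3%:R != 0 :> Fq).

Local Notation R := (integral P).
Local Notation M := (small P).

Lemma one_integral : R 1. Proof. exact: (integral_nat P 1). Qed.

Lemma a_integral : R a.
Proof.
case: ab_small => [/small_integral //|hb].
by rewrite -(subrK b a) ab1 integralD ?one_integral ?small_integral.
Qed.

Lemma b_integral : R b.
Proof.
rewrite (_ : b = a - 1); last by rewrite -ab1; ring.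
by rewrite integralB ?a_integral ?one_integral.
Qed.

Local Ltac int := repeat first
  [ assumption | exact: integral_nat | apply: integralX | apply: integralM
  | apply: integralB | apply: integralD | exact: a_integral
  | exact: b_integral ].

Local Ltac sml := first
  [ assumption | apply: smallB; [sml | sml] | apply: smallD; [sml | sml]
  | apply: smallM; [solve [int] | sml] | rewrite mulrC; apply: smallM; [solve [int] | sml] ].

Lemma cubic_mul_integral u v :
  all3 R u -> all3 R v -> all3 R (cubic_mul a b u v).
Proof.
case: u v => -[u0 u1] u2 [[v0 v1] v2] /and3P[? ? ?] /and3P[? ? ?].
by apply/and3P; split; int.
Qed.

Lemma cubic_mul_small u v :
  all3 R u -> all3 M v -> all3 M (cubic_mul a b u v).
Proof.
case: u v => -[u0 u1] u2 [[v0 v1] v2] /and3P[? ? ?] /and3P[? ? ?].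
by apply/and3P; split; sml.
Qed.

(** Compute modulo the maximal ideal.  If a vanishes there then b = -1, and
Y^3 - 1 is separable since 3 is invertible; its discriminant -27 is behind the
factor 9 below.  If b vanishes then a = 1 and the algebra splits at the roots
0, 1, -1, which are distinct since 2 is invertible. *)
Lemma cubic_reduced u : all3 R u -> all3 M (cubic_mul a b u u) -> all3 M u.
Proof.
case: u => -[u0 u1] u2 /and3P[i0 i1 i2] /and3P[].
set d0 := _ - _; set d1 := _ - _; set d2 := _ + _ => s0 s1 s2.
case: ab_small => [ha|hb].
- have Eb : b = a - 1 by rewrite -ab1; ring.
  have : M (u0 ^+ 2 + 2%:R * u1 * u2).
    rewrite (_ : _ + _ = d0 + (2%:R * u1 * u2) * a); last by rewrite /d0 Eb; ring.
    by sml.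
  have : M (2%:R * u0 * u1 + u2 ^+ 2).
    rewrite (_ : _ + _ = d1 - (2%:R * u1 * u2 - u2 ^+ 2) * a).
      by sml.
    by rewrite /d1 Eb; ring.
  have : M (u1 ^+ 2 + 2%:R * u0 * u2).
    rewrite (_ : _ + _ = d2 - u2 ^+ 2 * a); last by rewrite /d2; ring.
    by sml.
  set g2 := u1 ^+ 2 + _; set g1 := _ + u2 ^+ 2; set g0 := u0 ^+ 2 + _ => t2 t1 t0.
  have h2 : M u2.
    do 2 (apply: small_sqr; first by int).
    (* Eliminating u0 and u1 from the equations g0 = g1 = g2 = 0 of a
       square-zero element leaves 9 u2^4 = 0. *)
    do 2 (apply: (small_natM three_neq0); first by int).
    rewrite (_ : 3%:R * _ = (9%:R * u2 ^+ 2 - 2%:R * u0 * u1) * g1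
       + 4%:R * u1 ^+ 2 * g0 - (8%:R * u1 * u2) * g2).
      by sml.
    by rewrite /g0 /g1 /g2; ring.
  have h1 : M u1.
    apply: small_sqr => //; rewrite -(addrK (2%:R * u0 * u2) (u1 ^+ 2)).
    by sml.
  apply/and3P; split=> //; apply: small_sqr => //.
  rewrite -(addrK (2%:R * u1 * u2) (u0 ^+ 2)).
  by sml.
- have Ea : a = b + 1 by rewrite -ab1; ring.
  have h0 : M u0.
    apply: small_sqr => //.
    rewrite (_ : _ ^+ 2 = d0 + (2%:R * u1 * u2) * b); last by rewrite /d0; ring.
    by sml.
  have h12 : M (u1 ^+ 2 + u2 ^+ 2).
    rewrite (_ : _ + _ = d2 - (2%:R * u2) * u0 - u2 ^+ 2 * b).
      by sml.
    by rewrite /d2 Ea; ring.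
  have [h|h] : M u1 \/ M u2.
    apply: small_prime => //; apply: (small_natM two_neq0); first by int.
    rewrite (_ : _ * _ = d1 - (2%:R * u1) * u0
       - (2%:R * u1 * u2 - u2 ^+ 2) * b).
      by sml.
    by rewrite /d1 Ea; ring.
  + apply/and3P; split=> //; apply: small_sqr => //.
    rewrite (_ : _ ^+ 2 = u1 ^+ 2 + u2 ^+ 2 - u1 * u1); last by ring.
    by sml.
  + apply/and3P; split=> //; apply: small_sqr => //.
    rewrite (_ : _ ^+ 2 = u1 ^+ 2 + u2 ^+ 2 - u2 * u2); last by ring.
    by sml.
Qed.

End CubicAlgebra.

(** * Coordinates in the power basis, scaled to size 1 *)

Section Coordinates.

Variables (Fq : finFieldType) (L : fieldExtType (ratfun Fq)).
Variables (A B : {poly Fq}) (y : L).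
Hypothesis std : standard_form A B y.

Local Notation emb := (@ratfun_emb Fq L).

Lemma embD : {morph emb : c d / c + d}. Proof. exact: (rmorphD (in_alg L)). Qed.
Lemma embB : {morph emb : c d / c - d}. Proof. exact: (rmorphB (in_alg L)). Qed.
Lemma embM : {morph emb : c d / c * d}. Proof. exact: (rmorphM (in_alg L)). Qed.
Let embE := (embB, embD, embM).

Lemma ratfun_coordinates z : exists c0 c1 c2 : ratfun Fq,
  z = emb c0 + emb c1 * y + emb c2 * y ^+ 2.
Proof.
have zy : z \in <<1; y>>%VS by rewrite (std_gen std) memvf.
have [q Dq] := polyOver1P (Fadjoin_polyOver 1%AS y z).
rewrite -(Fadjoin_poly_eq zy) Dq; elim/poly_ind: q {zy Dq} => [|q c [c0 [c1 [c2 E]]]].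
  by exists 0, 0, 0; rewrite rmorph0 horner0 /ratfun_emb scale0r !mul0r !addr0.
exists (c - c2 * tofrac B), (c0 + c2 * tofrac A), c1.
rewrite rmorphD rmorphM /= map_polyX map_polyC hornerMXaddC E /=.
rewrite -[LHS]subr0 -(mulr0 (emb c2)) -(std_root std) -/(emb c) !embE.
by rewrite /poly_emb; ring.
Qed.

(** The coefficients in the power basis are unique, so y and 0 differ. *)
Lemma y_neq0 : y != 0.
Proof.
apply/eqP => y0.
have [_ E1 _] := ycoefE 0 1 0 std; have [_ E0 _] := ycoefE 0 0 0 std.
have E : emb 0 + emb 1 * y + emb 0 * y ^+ 2 = emb 0 + emb 0 * y + emb 0 * y ^+ 2.
  by rewrite y0 !mulr0.
move/eqP: E1; rewrite E E0 /ratfun_emb scale1r scale0r.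
by rewrite eq_sym oner_eq0.
Qed.

(** The monomials c_i y^i, rather than the c_i, are the coordinates: they lie in
L, so that P measures them directly and t can be any nonzero element of L. *)
Definition scaled_coord (t z : L) : L * L * L :=
  (ycoef y z 0 / t, ycoef y z 1 * y / t, ycoef y z 2 * y ^+ 2 / t).

Lemma scaled_coord1 : scaled_coord 1 1 = (1, 0, 0).
Proof.
have [E0 E1 E2] := ycoefE 1 0 0 std; move: E0 E1 E2.
rewrite /scaled_coord /ratfun_emb scale1r scale0r !mul0r !addr0 => -> -> ->.
by rewrite !mul0r divr1.
Qed.

(** The substitution of y * Y for the generator turns the equation of y into
Y^3 - a Y + b = 0. *)
Lemma scaled_coordM s t z w : s != 0 -> t != 0 ->
  scaled_coord (s * t) (z * w) =
  cubic_mul (poly_emb L A / y ^+ 2) (poly_emb L B / y ^+ 3)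
    (scaled_coord s z) (scaled_coord t w).
Proof.
move=> s0 t0; have y0 := y_neq0.
have [c0 [c1 [c2 ->]]] := ratfun_coordinates z.
have [d0 [d1 [d2 ->]]] := ratfun_coordinates w.
pose a := tofrac A; pose b := tofrac B.
pose e0 := c0 * d0 - (c1 * d2 + c2 * d1) * b.
pose e1 := c0 * d1 + c1 * d0 + (c1 * d2 + c2 * d1) * a - c2 * d2 * b.
pose e2 := c0 * d2 + c1 * d1 + c2 * d0 + c2 * d2 * a.
have E0 : emb e0 = emb c0 * emb d0 - (emb c1 * emb d2 + emb c2 * emb d1) * emb b.
  by rewrite !embE.
have E1 : emb e1 = emb c0 * emb d1 + emb c1 * emb d0
    + (emb c1 * emb d2 + emb c2 * emb d1) * emb a - emb c2 * emb d2 * emb b.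
  by rewrite !embE.
have E2 : emb e2 = emb c0 * emb d2 + emb c1 * emb d1 + emb c2 * emb d0
    + emb c2 * emb d2 * emb a.
  by rewrite !embE.
have -> : (emb c0 + emb c1 * y + emb c2 * y ^+ 2)
    * (emb d0 + emb d1 * y + emb d2 * y ^+ 2)
    = emb e0 + emb e1 * y + emb e2 * y ^+ 2.
  rewrite -[RHS]addr0.
  rewrite -(mulr0 (emb c1 * emb d2 + emb c2 * emb d1 + emb c2 * emb d2 * y)).
  by rewrite -(std_root std) E0 E1 E2 /a /b /poly_emb; ring.
rewrite /scaled_coord /poly_emb -/a -/b.
have [-> -> ->] := ycoefE e0 e1 e2 std.
have [-> -> ->] := ycoefE c0 c1 c2 std.
have [-> -> ->] := ycoefE d0 d1 d2 std.
rewrite E0 E1 E2 /cubic_mul.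
move: (emb c0) (emb c1) (emb c2) (emb d0) (emb d1) (emb d2) (emb a) (emb b).
move=> *; congr (_, _, _); field; by rewrite s0 t0 y0.
Qed.

End Coordinates.

(** * The maximum value of a power *)

Section MaximumValue.

Variables (Fq : finFieldType) (L : fieldExtType (ratfun Fq)).
Variables (A B : {poly Fq}) (y : L) (P : place L).
Hypothesis std : standard_form A B y.

(** An element t of L whose value is the smallest value of a coordinate of z, as
the content of a polynomial in Gauss's lemma. *)
Definition is_content (t z : L) : bool :=
  [&& t != 0, all3 (integral P) (scaled_coord y t z)
    & ~~ all3 (small P) (scaled_coord y t z)].

Lemma maxval_content t z : is_content t z -> maxval P y z = (- P t)%E.
Proof.
case/and3P => t0; rewrite /all3 /scaled_coord !integral_div // !small_div //.
case/and3P => le0 le1 le2 nlt; apply/eqP; rewrite eq_le /maxval.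
rewrite !ge_max !leeN2 le0 le1 le2 /= !le_max !leeN2 !leNgt.
by rewrite -!negb_and.
Qed.

Lemma exists_content z : z != 0 -> exists t, is_content t z.
Proof.
move=> z0; set u0 := ycoef y z 0; set u1 := ycoef y z 1 * y.
set u2 := ycoef y z 2 * y ^+ 2.
pose w := if (P u1 <= P u2)%E then u1 else u2.
pose t := if (P u0 <= P w)%E then u0 else w.
have [t0 t1 t2] : [/\ P t <= P u0, P t <= P u1 & P t <= P u2]%E.
  have [w1 w2] : (P w <= P u1)%E /\ (P w <= P u2)%E.
    by rewrite /w; case: (leP (P u1) (P u2)) => [h|/ltW h]; split.
  rewrite /t; case: (leP (P u0) (P w)) => [h|/ltW h]; last by split.
  by split=> //; [apply: le_trans w1 | apply: le_trans w2].
have tE : [|| t == u0, t == u1 | t == u2].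
  by rewrite /t /w; do 2 case: ifP; rewrite eqxx ?orbT.
have tn0 : t != 0.
  apply: contra_neqN z0 => /eqP tz; move: t0 t1 t2; rewrite tz place_v0 !leye_eq.
  have v0 u : P u == +oo%E -> u = 0.
    by move=> h; apply: contraTeq h => /(place_v_fin P); case: (P u).
  move=> /v0 e0 /v0 e1 /v0 e2; have y0 := y_neq0 std.
  have [c0 [c1 [c2 E]]] := ratfun_coordinates std z.
  have := ycoefE c0 c1 c2 std; rewrite -E => -[E0 E1 E2].
  rewrite E -E0 -E1 -E2 -/u0 -/u1 -/u2 e0 e1 e2.
  by rewrite !addr0.
exists t; rewrite /is_content tn0 /all3 /scaled_coord !integral_div //.
rewrite -/u0 -/u1 -/u2 t0 t1 t2 /= !small_div //.
by case/or3P: tE => /eqP <-; rewrite ltxx ?andbF.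
Qed.

Hypotheses (two_neq0 : 2%:R != 0 :> Fq) (three_neq0 : 3%:R != 0 :> Fq).
Let a := poly_emb L A / y ^+ 2.
Let b := poly_emb L B / y ^+ 3.
Hypothesis ab_small : small P a \/ small P b.

Lemma ab_eq1 : a - b = 1.
Proof.
have y0 := y_neq0 std.
have cubicE : poly_emb L A * y - poly_emb L B = y ^+ 3.
  by rewrite -[LHS]addr0 -(std_root std); ring.
have -> : a - b = (poly_emb L A * y - poly_emb L B) / y ^+ 3 by rewrite /a /b; field.
by rewrite cubicE divff // expf_neq0.
Qed.

(** If the scaled coordinates of z^k vanished in the residue field, so would
those of z^(2^k), because k <= 2^k; extracting square roots k times in the
reduced residue algebra then gives the same for z. *)
Lemma content_expn t z k : is_content t z -> is_content (t ^+ k) (z ^+ k).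
Proof.
case/and3P => t0 int_tz nsmall_tz.
have tX n : t ^+ n != 0 by rewrite expf_neq0.
pose u n := scaled_coord y (t ^+ n) (z ^+ n).
have uD m n : u (m + n)%N = cubic_mul a b (u m) (u n).
  by rewrite /u !exprD (scaled_coordM std) ?tX.
have int_u n : all3 (integral P) (u n).
  elim: n => [|n IH].
    by rewrite /u !expr0 (scaled_coord1 std) /= !(integral_nat P 0) (integral_nat P 1).
  by rewrite -addn1 uD cubic_mul_integral // ab_eq1.
apply/and3P; split; [exact: tX | exact: int_u | ].
apply: contra nsmall_tz => small_k.
have : all3 (small P) (u (2 ^ k)%N).
  rewrite -(subnK (ltnW (ltn_expl k (ltnSn 1)))) uD.
  by apply: cubic_mul_small => //; exact: ab_eq1.
rewrite -[scaled_coord y t z]/(u 1%N) -(expn0 2).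
elim: {small_k} k => // k IH; rewrite expnS mul2n -addnn uD => h.
by apply: IH; apply: cubic_reduced h => //; exact: ab_eq1.
Qed.

Lemma maxval_expn z k : z != 0 ->
  maxval P y (z ^+ k) = ((Posz k)%:E * maxval P y z)%E.
Proof.
move=> /exists_content[t ct]; have t0 : t != 0 by case/and3P: ct.
rewrite (maxval_content ct) (maxval_content (content_expn k ct)).
by rewrite place_vX // muleN.
Qed.

End MaximumValue.

(** * The reduction of the cubic at a critical place *)

Section CriticalPlace.

Variables (Fq : finFieldType) (L : fieldExtType (ratfun Fq)).
Variables (A B : {poly Fq}) (y : L) (P : place L) (e : nat).
Hypotheses (std : standard_form A B y) (crit : critical_place A B y P e).

Lemma place_poly G : P (poly_emb L G) = (- ((Posz e)%:E * deg G))%E.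
Proof.
have [_ [_ ->] _ _] := crit.
have := vinf_frac G (oner_neq0 {poly Fq}).
rewrite tofrac1 divr1 => ->.
by rewrite /deg oner_eq0 size_poly1 /= add0e muleN.
Qed.

(** Criticality says that the dominant one of a, b has value 0; the strict
inequality between 3 deg A and 2 deg B makes the other one positive. *)
Lemma critical_small : (3%:E * deg A)%E <> (2%:E * deg B)%E ->
  small P (poly_emb L A / y ^+ 2) \/ small P (poly_emb L B / y ^+ 3).
Proof.
have y0 := y_neq0 std; have [_ [e0 _] hA hB] := crit.
rewrite !small_div ?expf_neq0 // !place_vX // !place_poly.
have eNy : ((Posz e)%:E * -oo = -oo :> \bar int)%E.
  by rewrite mulrNy gtr0_sg ?mul1e // ltz_nat.
(* Both cases at once: G is the coefficient of smaller weighted degree. *)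
have deg_lt (G H : {poly Fq}) (m n : nat) : (0 < m)%N -> (0 < n)%N ->
    (m%:Z%:E * deg G < n%:Z%:E * deg H)%E ->
    (m%:Z%:E * P y = - ((Posz e)%:E * deg H))%E ->
    (n%:Z%:E * P y < - ((Posz e)%:E * deg G))%E.
  move=> m0 n0; case: (P y) (place_v_fin P y0) => // s _; rewrite /deg.
  have [_|_] := eqVneq H 0.
    by rewrite eNy -EFinM.
  have [_ _ _|_] := eqVneq G 0; first by rewrite eNy -EFinM ltry.
  rewrite -!EFinM -!EFinN !lte_fin => lt [eq].
  (* Multiplying by m brings in m * s, the value known by criticality. *)
  have : (m%:Z * (n%:Z * s) < m%:Z * - (e%:Z * (size G).-1%:Z)); last first.
    by rewrite ltr_pM2l // ltz_nat.
  rewrite mulrCA eq; move: lt e0; move: (size G).-1 (size H).-1 => g h lt e0.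
  have : 0 < (e%:Z * (n%:Z * h%:Z - m%:Z * g%:Z)); last by lia.
  by rewrite mulr_gt0 ?ltz_nat // subr_gt0.
by move=> /eqP; rewrite neq_lt => /orP[lt|lt];
  [left; apply: deg_lt (hB lt) | right; apply: deg_lt (hA lt)].
Qed.

End CriticalPlace.

Theorem lemma2p4p4 (Fq : finFieldType) (p : nat)
    (hchar : p \in [pchar Fq]) (hp : (5 <= p)%N)
    (L : fieldExtType (ratfun Fq)) (y : L) (A B : {poly Fq})
    (hstd : standard_form A B y)
    (hdeg : (3%:E * deg A)%E <> (2%:E * deg B)%E)
    (P1 : place L) (hP1 : minimal_critical_place A B y P1)
    (alpha : L) (a0 a1 a2 : {poly Fq})
    (halpha : alpha = poly_emb L a0 + poly_emb L a1 * y
                      + poly_emb L a2 * y ^+ 2)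
    (hunit : unit_O alpha) (k : nat) :
  maxval P1 y (alpha ^+ k) = ((Posz k)%:E * maxval P1 y alpha)%E.
Proof.
have [e crit _] := hP1.
have natr_neq0 n : (0 < n < 5)%N -> n%:R != 0 :> Fq.
  case/andP => n0 n5; rewrite -(dvdn_pcharf hchar).
  by rewrite gtnNdvd // (leq_trans n5).
have alpha0 : alpha != 0.
  have [_ [w _ aw1]] := hunit.
  by apply: contra_eq_neq aw1 => ->; rewrite mul0r eq_sym oner_neq0.
apply: (maxval_expn hstd) => //; try exact: natr_neq0.
exact: critical_small hstd crit hdeg.
Qed.
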